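(* Let $\mathfrak g=\mathrm T^*\mathfrak h_3$ with basis $e_1,\dots,e_6$, non-zero commutators $[e_1,e_2]=e_6$, $[e_1,e_3]=-e_5$, $[e_2,e_3]=e_4$, and $\mathfrak g'=\mathbb R\langle e_4,e_5,e_6\rangle$. For left invariant pseudo-Riemannian metrics on $\mathfrak g$ the following hold. (i) If $\mathfrak g'$ is non-degenerate, the metric cannot be flat or Ricci-flat. (ii) If $\mathfrak g'$ is degenerate of rank 2: the metrics $(S,M,\pm E_{20})$ with $(S,M)$ of form (b), and the metrics $(S,M,E_{11})$ with $(S,M)$ of form (b), (f) or (g), are Ricci-parallel. Specially, Ricci-flat are the metrics, all with $M=\mathrm{diag}(1,0,0)$: $(S,M,\pm E_{20})$ with $S=\mathrm{diag}(0,s_{22},\pm1-s_{22})$ (same sign); $(S,M,E_{11})$ with $S=\mathrm{diag}(0,s_{22},-1+s_{22})$; $(S,M,E_{11})$ with $S=\begin{pmatrix}0&0&0\\0&1&\frac12\\0&\frac12&0\end{pmatrix}$; $(S,M,E_{11})$ with $S=\begin{pmatrix}0&0&0\\0&0&\frac12\\0&\frac12&-1\end{pmatrix}$. (iii) If $\mathfrak g'$ is degenerate of rank 1: the metrics $(\pm E_{10},M,E_{10})$ with $M$ of one of the forms $\begin{pmatrix}m_{11}&0&0\\0&m_{22}&0\\0&0&0\end{pmatrix}$, $\begin{pmatrix}m_{11}&m_{12}&0\\-m_{12}&m_{11}&0\\0&0&0\end{pmatrix}$, $\begin{pmatrix}m_{11}&0&0\\1&m_{11}&0\\0&0&0\end{pmatrix}$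 are locally symmetric and Ricci-flat. Specially, the metrics $(E_{10},M,E_{10})$ with $M=\mathrm{diag}(\lambda\pm\sqrt3,\lambda,0)$ and $(-E_{10},M,E_{10})$ with $M=\begin{pmatrix}\lambda_1&\mp\frac{\sqrt3}2&0\\ \pm\frac{\sqrt3}2&\lambda_1&0\\0&0&0\end{pmatrix}$ are flat. Also, the metrics $(\pm E_{10},M,\pm E_{10})$ with $M=\begin{pmatrix}0&\lambda&0\\1&0&0\\1&0&0\end{pmatrix}$ are Ricci-parallel. (iv) If $\mathfrak g'$ is degenerate of rank 0, the metric is flat. (v) The only Einstein metrics (i.e. metrics whose Ricci tensor is proportional to the metric tensor) are the Ricci-flat ones.
   Context: A left invariant metric is identified with a non-degenerate symmetric bilinear form on $\mathfrak g$. The triple $(S,M,E)$ of $3\times 3$ matrices denotes the metric with Gram matrix $\begin{pmatrix}S&M\\ M^T&E\end{pmatrix}$ in the basis $e$; all parameters are real and such that the metric is non-degenerate. ''Rank'' refers to the restriction of the metric to $\mathfrak g'$. Notation: $E_{20}=\mathrm{diag}(0,1,1)$, $E_{11}=\mathrm{diag}(0,1,-1)$, $E_{10}=\mathrm{diag}(0,0,1)$. Forms, all with $M=\mathrm{diag}(1,0,0)$: (b) $S=\mathrm{diag}(0,s_{22},s_{33})$, $s_{22},s_{33}\ne0$; (f) $S=\begin{pmatrix}0&0&0\\0&s_{22}&\frac12|s_{22}|\\0&\frac12|s_{22}|&0\end{pmatrix}$, $s_{22}\ne0$; (g) $S=\begin{pmatrix}0&0&0\\0&0&\frac12|s_{33}|\\0&\frac12|s_{33}|&s_{33}\end{pmatrix}$,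 $s_{33}\ne0$. With $\nabla$ the Levi-Civita connection, $R(x,y)z=\nabla_x\nabla_yz-\nabla_y\nabla_xz-\nabla_{[x,y]}z$ and $\rho(x,y)=\mathrm{Tr}(z\mapsto R(z,x)y)$: flat means $R=0$, locally symmetric means $\nabla R=0$, Ricci-flat means $\rho=0$, Ricci-parallel means $\nabla\rho=0$. *)

(* Defs.v *)
From HB Require Import structures.
From mathcomp Require Export all_boot all_order all_algebra.
From mathcomp Require Export reals.
From mathcomp Require Import ring.

Set Implicit Arguments.
Unset Strict Implicit.
Unset Printing Implicit Defensive.

Import Order.TTheory GRing.Theory Num.Theory.
Local Open Scope ring_scope.

(* The Lie algebra T^*h_3 is modelled on row vectors of length 6.  Basis      *)
(* vectors and coordinates are numbered from 1 to 6.                          *)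
Definition e {R : realType} (k : nat) : 'rV[R]_6 := \row_(j < 6) (j.+1 == k)%:R.

Definition crd {R : realType} (x : 'rV[R]_6) (k : nat) : R := x 0 (inord k.-1).

Definition bracket {R : realType} (x y : 'rV[R]_6) : 'rV[R]_6 :=
  (crd x 1 * crd y 2 - crd x 2 * crd y 1) *: e 6
  - (crd x 1 * crd y 3 - crd x 3 * crd y 1) *: e 5
  + (crd x 2 * crd y 3 - crd x 3 * crd y 2) *: e 4.

(* The rows e_4, e_5, e_6 form a basis of the derived algebra.                *)
Definition derived_basis {R : realType} : 'M[R]_(3, 6) := \matrix_(i < 3) e (i + 4).

(* A symmetric bilinear form on the algebra is given by its Gram matrix G     *)
(* in the basis e.                                                            *)
Definition bform {R : realType} (G : 'M[R]_6) (x y : 'rV[R]_6) : R :=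
  (x *m G *m y^T) 0 0.

Definition is_metric {R : realType} (G : 'M[R]_6) : Prop :=
  G^T = G /\ G \in unitmx.

Definition derived_gram {R : realType} (G : 'M[R]_6) : 'M[R]_3 :=
  derived_basis *m G *m derived_basis^T.

Definition derived_nondegenerate {R : realType} (G : 'M[R]_6) : Prop :=
  derived_gram G \in unitmx.

Definition derived_degenerate_of_rank {R : realType} (r : nat) (G : 'M[R]_6) : Prop :=
  derived_gram G \notin unitmx /\ \rank (derived_gram G) = r.

(* Left invariant connections: on left invariant fields the inner products    *)
(* are constant, so the derivative terms of metric compatibility vanish.      *)
Definition is_levi_civita {R : realType} (G : 'M[R]_6)
    (nabla : 'rV[R]_6 -> 'rV[R]_6 -> 'rV[R]_6) : Prop :=
  [/\ forall x, linear (nabla x),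
      forall y, linear (nabla^~ y),
      forall x y, nabla x y - nabla y x = bracket x y &
      forall x y z, bform G (nabla x y) z + bform G y (nabla x z) = 0].

(* Koszul formula: the right-hand side is bform G (nabla x y) z.               *)
Definition koszul {R : realType} (G : 'M[R]_6) (x y z : 'rV[R]_6) : R :=
  (bform G (bracket x y) z - bform G (bracket y z) x + bform G (bracket z x) y) / 2.

(* For a metric G this is the unique connection satisfying [is_levi_civita],  *)
(* see [levi_civitaP].                                                        *)
Definition levi_civita {R : realType} (G : 'M[R]_6) (x y : 'rV[R]_6) : 'rV[R]_6 :=
  (\row_(k < 6) koszul G x y (e k.+1)) *m invmx G.

Definition curv {R : realType} (G : 'M[R]_6) (x y z : 'rV[R]_6) : 'rV[R]_6 :=
  let nabla := levi_civita G in
  nabla x (nabla y z) - nabla y (nabla x z) - nabla (bracket x y) z.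

Definition ricci {R : realType} (G : 'M[R]_6) (x y : 'rV[R]_6) : R :=
  \tr (lin1_mx (fun z => curv G z x y)).

Definition nabla_curv {R : realType} (G : 'M[R]_6) (w x y z : 'rV[R]_6) : 'rV[R]_6 :=
  let nabla := levi_civita G in
  nabla w (curv G x y z) - curv G (nabla w x) y z
  - curv G x (nabla w y) z - curv G x y (nabla w z).

Definition nabla_ricci {R : realType} (G : 'M[R]_6) (w x y : 'rV[R]_6) : R :=
  let nabla := levi_civita G in
  - ricci G (nabla w x) y - ricci G x (nabla w y).

Definition flat {R : realType} (G : 'M[R]_6) : Prop :=
  forall x y z, curv G x y z = 0.

Definition locally_symmetric {R : realType} (G : 'M[R]_6) : Prop :=
  forall w x y z, nabla_curv G w x y z = 0.

Definition ricci_flat {R : realType} (G : 'M[R]_6) : Prop :=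
  forall x y, ricci G x y = 0.

Definition ricci_parallel {R : realType} (G : 'M[R]_6) : Prop :=
  forall w x y, nabla_ricci G w x y = 0.

Definition einstein {R : realType} (G : 'M[R]_6) : Prop :=
  exists c : R, forall x y, ricci G x y = c * bform G x y.

Definition triple {R : realType} (S M E : 'M[R]_3) : 'M[R]_6 :=
  block_mx S M M^T E.

Definition mx3 {R : realType} (rows : seq (seq R)) : 'M[R]_3 :=
  \matrix_(i < 3, j < 3) (nth [::] rows i)`_j.

Definition diag3 {R : realType} (a b c : R) : 'M[R]_3 :=
  mx3 [:: [:: a; 0; 0]; [:: 0; b; 0]; [:: 0; 0; c]].

Definition E20 {R : realType} : 'M[R]_3 := diag3 0 1 1.
Definition E11 {R : realType} : 'M[R]_3 := diag3 0 1 (-1).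
Definition E10 {R : realType} : 'M[R]_3 := diag3 0 0 1.

Definition form_b {R : realType} (S M : 'M[R]_3) : Prop :=
  exists s22 s33 : R, [/\ s22 != 0, s33 != 0,
    S = diag3 0 s22 s33 & M = diag3 1 0 0].

Definition form_f {R : realType} (S M : 'M[R]_3) : Prop :=
  exists s22 : R, [/\ s22 != 0,
    S = mx3 [:: [:: 0; 0; 0]; [:: 0; s22; `|s22| / 2]; [:: 0; `|s22| / 2; 0]] &
    M = diag3 1 0 0].

Definition form_g {R : realType} (S M : 'M[R]_3) : Prop :=
  exists s33 : R, [/\ s33 != 0,
    S = mx3 [:: [:: 0; 0; 0]; [:: 0; 0; `|s33| / 2]; [:: 0; `|s33| / 2; s33]] &
    M = diag3 1 0 0].

(* In the predicates below a sign is a boolean b read as (-1) ^+ b, so that a *)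
(* repeated b means "same sign" and distinct booleans mean independent signs. *)

Definition rank2_ricci_parallel_list {R : realType} (G : 'M[R]_6) : Prop :=
  (exists (b : bool) (S M : 'M[R]_3),
     form_b S M /\ G = triple S M ((-1) ^+ b *: E20))
  \/ (exists S M : 'M[R]_3,
     [\/ form_b S M, form_f S M | form_g S M] /\ G = triple S M E11).

Definition rank2_ricci_flat_list {R : realType} (G : 'M[R]_6) : Prop :=
  [\/ exists (b : bool) (s22 : R),
        G = triple (diag3 0 s22 ((-1) ^+ b - s22)) (diag3 1 0 0) ((-1) ^+ b *: E20),
      exists s22 : R, G = triple (diag3 0 s22 (-1 + s22)) (diag3 1 0 0) E11,
      G = triple (mx3 [:: [:: 0; 0; 0]; [:: 0; 1; 2^-1]; [:: 0; 2^-1; 0]])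
            (diag3 1 0 0) E11 |
      G = triple (mx3 [:: [:: 0; 0; 0]; [:: 0; 0; 2^-1]; [:: 0; 2^-1; -1]])
            (diag3 1 0 0) E11].

Definition rank1_locally_symmetric_list {R : realType} (G : 'M[R]_6) : Prop :=
  exists (b : bool) (M : 'M[R]_3),
    [\/ exists m11 m22 : R,
          M = mx3 [:: [:: m11; 0; 0]; [:: 0; m22; 0]; [:: 0; 0; 0]],
        exists m11 m12 : R,
          M = mx3 [:: [:: m11; m12; 0]; [:: - m12; m11; 0]; [:: 0; 0; 0]] |
        exists m11 : R,
          M = mx3 [:: [:: m11; 0; 0]; [:: 1; m11; 0]; [:: 0; 0; 0]]]
    /\ G = triple ((-1) ^+ b *: E10) M E10.

Definition rank1_flat_list {R : realType} (G : 'M[R]_6) : Prop :=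
  (exists (b : bool) (l : R),
     G = triple E10 (diag3 (l + (-1) ^+ b * Num.sqrt 3) l 0) E10)
  \/ (exists (b : bool) (l1 : R),
     G = triple (- E10)
           (mx3 [:: [:: l1; - ((-1) ^+ b * (Num.sqrt 3 / 2)); 0];
                    [:: (-1) ^+ b * (Num.sqrt 3 / 2); l1; 0];
                    [:: 0; 0; 0]]) E10).

Definition rank1_ricci_parallel_list {R : realType} (G : 'M[R]_6) : Prop :=
  exists (b1 b2 : bool) (l : R),
    G = triple ((-1) ^+ b1 *: E10)
          (mx3 [:: [:: 0; l; 0]; [:: 1; 0; 0]; [:: 1; 0; 0]])
          ((-1) ^+ b2 *: E10).

Lemma bracket_e {R : realType} :
  [/\ bracket (e 1) (e 2) = e 6 :> 'rV[R]_6,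
      bracket (e 1) (e 3) = - e 5 :> 'rV[R]_6 &
      bracket (e 2) (e 3) = e 4 :> 'rV[R]_6].
Proof.
rewrite /bracket /crd; split; rewrite !mxE !inordK //=;
by rewrite !(mul0r, mulr0, mul1r, subr0, sub0r, scale0r, scale1r, oppr0, addr0, add0r).
Qed.

Lemma bracket_derived {R : realType} (x y : 'rV[R]_6) :
  (bracket x y <= derived_basis)%MS.
Proof.
have h (i : 'I_3) : (@e R (i + 4) <= derived_basis)%MS.
  by rewrite -[e _](rowK (fun i : 'I_3 => e (i + 4))); apply: row_sub.
rewrite /bracket; apply: addmx_sub; [apply: addmx_sub|].
- exact: scalemx_sub (h (@Ordinal 3 2 isT)).
- rewrite -scaleNr; exact: scalemx_sub (h (@Ordinal 3 1 isT)).
- exact: scalemx_sub (h (@Ordinal 3 0 isT)).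
Qed.

Lemma derived_gram_triple {R : realType} (S M E : 'M[R]_3) :
  derived_gram (triple S M E) = E.
Proof.
rewrite /derived_gram; have -> : @derived_basis R = row_mx 0 1%:M :> 'M_(3, 3 + 3).
  apply/matrixP => i j; rewrite [LHS]mxE [LHS]mxE.
  case: (split_ordP (j : 'I_(3 + 3))) => k ->; rewrite ?row_mxEl ?row_mxEr !mxE /=.
    by rewrite addnS eqSS ltn_eqF // (leq_trans (ltn_ord k)) ?leq_addl.
  by rewrite addnS eqSS addnC eqn_add2r eq_sym.
pose B : 'M[R]_(3, 3 + 3) := row_mx 0 1%:M.
rewrite -[LHS]/(B *m block_mx S M M^T E *m B^T) /B tr_row_mx mul_row_block mul_row_col.
by rewrite !(trmx0, trmx1, mul0mx, mul1mx, mulmx0, mulmx1, add0r).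
Qed.

Lemma bformDl {R : realType} (G : 'M[R]_6) x y z :
  bform G (x + y) z = bform G x z + bform G y z.
Proof. by rewrite /bform !mulmxDl mxE. Qed.

Lemma bformZl {R : realType} (G : 'M[R]_6) a x z :
  bform G (a *: x) z = a * bform G x z.
Proof. by rewrite /bform -!scalemxAl mxE. Qed.

Lemma bformC {R : realType} (G : 'M[R]_6) x y :
  G^T = G -> bform G x y = bform G y x.
Proof.
move=> sG; rewrite /bform -[in LHS]sG.
have -> : x *m G^T *m y^T = (y *m G *m x^T)^T by rewrite !trmx_mul trmxK mulmxA.
by rewrite mxE.
Qed.

Lemma bformDr {R : realType} (G : 'M[R]_6) x y z :
  bform G z (x + y) = bform G z x + bform G z y.
Proof. by rewrite /bform linearD /= mulmxDr mxE. Qed.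

Lemma bformZr {R : realType} (G : 'M[R]_6) a x z :
  bform G z (a *: x) = a * bform G z x.
Proof. by rewrite /bform linearZ /= -scalemxAr mxE. Qed.

Lemma bracket_linl {R : realType} (a : R) x y z :
  bracket (a *: x + y) z = a *: bracket x z + bracket y z.
Proof. by rewrite /bracket /crd; apply/rowP => j; rewrite !mxE; ring. Qed.

Lemma bracket_linr {R : realType} (a : R) x y z :
  bracket z (a *: x + y) = a *: bracket z x + bracket z y.
Proof. by rewrite /bracket /crd; apply/rowP => j; rewrite !mxE; ring. Qed.

Lemma bracketC {R : realType} (x y : 'rV[R]_6) : bracket x y = - bracket y x.
Proof. by rewrite /bracket /crd; apply/rowP => j; rewrite !mxE; ring. Qed.

Lemma bracket_jacobi {R : realType} (x y z : 'rV[R]_6) :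
  bracket x (bracket y z) + bracket y (bracket z x) + bracket z (bracket x y) = 0.
Proof.
rewrite /bracket /crd; apply/rowP => j; rewrite !mxE !inordK //=; ring.
Qed.

Lemma row_sum_e {R : realType} (x : 'rV[R]_6) : x = \sum_(k < 6) x 0 k *: e k.+1.
Proof.
apply/rowP => j; rewrite summxE (bigD1 j) //= !mxE eqxx mulr1 big1 ?addr0 // => k.
by rewrite eq_sym !mxE eqSS -val_eqE /= => /negbTE ->; rewrite mulr0.
Qed.

Lemma bformE {R : realType} (G : 'M[R]_6) x z :
  bform G x z = \sum_(k < 6) z 0 k * bform G x (e k.+1).
Proof.
rewrite [in LHS](row_sum_e z); elim/big_ind2: _ => //.
- by rewrite /bform linear0 mulmx0 mxE.
- by move=> u a v b <- <-; rewrite bformDr.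
- by move=> k _; rewrite bformZr.
Qed.

Lemma koszul_lin {R : realType} (G : 'M[R]_6) x y a u v :
  koszul G x y (a *: u + v) = a * koszul G x y u + koszul G x y v.
Proof.
rewrite /koszul bracket_linr bracket_linl !(bformDl, bformDr, bformZl, bformZr).
by ring.
Qed.

Lemma bform_levi_civita {R : realType} (G : 'M[R]_6) x y z :
  G \in unitmx -> bform G (levi_civita G x y) z = koszul G x y z.
Proof.
move=> uG; rewrite /bform /levi_civita mulmxKV // mxE [in RHS](row_sum_e z).
have k0 : koszul G x y 0 = 0.
  by have := koszul_lin G x y (-1) 0 0; rewrite scaler0 addr0 mulN1r addNr.
symmetry; elim/big_ind2: _ => //.
- by move=> ? u ? v <- <-; rewrite -[u in LHS]scale1r koszul_lin mul1r.
- by move=> k _; rewrite -[_ *: _]addr0 koszul_lin k0 addr0 !mxE mulrC.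
Qed.

Lemma bform_inj {R : realType} (G : 'M[R]_6) u v :
  G \in unitmx -> (forall z, bform G u z = bform G v z) -> u = v.
Proof.
move=> uG h; rewrite -[u](mulmxK uG) -[v](mulmxK uG); congr (_ *m _).
apply/rowP => j; have := h (delta_mx 0 j).
by rewrite /bform trmx_delta -!colE !mxE.
Qed.

Lemma levi_civitaP {R : realType} (G : 'M[R]_6) nabla :
  is_metric G ->
  is_levi_civita G nabla <-> (forall x y, nabla x y = levi_civita G x y).
Proof.
move=> [sG uG]; split=> [[_ _ tf mc] x y | nE].
  apply: (bform_inj uG) => z; rewrite bform_levi_civita // /koszul -!tf.
  have t u v w : bform G (nabla u v - nabla v u) w
      = bform G (nabla u v) w - bform G (nabla v u) w.
    by rewrite -scaleN1r bformDl bformZl mulN1r.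
  rewrite !t.
  have m u v w : bform G (nabla u v) w = - bform G (nabla u w) v.
    by apply/eqP; rewrite -addr_eq0 (bformC (nabla u w)) // mc.
  rewrite (m x z y) (m y z x) (m z y x); by field; rewrite ?pnatr_eq0.
have B u v w : bform G (u - v) w = bform G u w - bform G v w.
  by rewrite -scaleN1r bformDl bformZl mulN1r.
have N u w : bform G (- u) w = - bform G u w.
  by rewrite -scaleN1r bformZl mulN1r.
split=> [x a u v|y a u v|x y|x y z]; rewrite !nE.
- apply: (bform_inj uG) => z.
  rewrite bformDl bformZl !bform_levi_civita // /koszul.
  by rewrite bracket_linr bracket_linl !(bformDl, bformDr, bformZl, bformZr); ring.
- apply: (bform_inj uG) => z.
  rewrite bformDl bformZl !bform_levi_civita // /koszul.
  by rewrite bracket_linr bracket_linl !(bformDl, bformDr, bformZl, bformZr); ring.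
- apply: (bform_inj uG) => z; rewrite B !bform_levi_civita // /koszul.
  rewrite (bracketC y x) (bracketC x z) (bracketC z y) !N; by field; rewrite ?pnatr_eq0.
- rewrite (bformC y) // !bform_levi_civita // /koszul.
  rewrite (bracketC y x) (bracketC x z) (bracketC z y) !N; by field; rewrite ?pnatr_eq0.
Qed.

(* Main.v *)
Require Import Defs.
From mathcomp Require Import ring lra zify.

Set Implicit Arguments.
Unset Strict Implicit.
Unset Printing Implicit Defensive.

Import Order.TTheory GRing.Theory Num.Theory.
Local Open Scope ring_scope.

(* Let P be the block of the inverse Gram matrix on e_1, e_2, e_3, let E be the
   Gram matrix of the derived algebra, and u_a(x) = <e_{a+3}, x>.  Since the
   algebra is 2-step nilpotent and its bracket is the cross product of R^3,
     2 Ric(x, y) = - sum_ij x_i y_j (P # E)_ij + sum_ab u_a(x) u_b(y) cof(P)_ab,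
   where P # E is the polarized cofactor matrix.  If E is invertible so is P,
   as the inverse of a Schur complement, so E cof(P) cannot vanish: this is (i).
   Tracing Ric = c G over the derived algebra and over a complement gives
   t/2 = 3c and -t = 3c with t = tr(E cof(P)): this is (v).
   In the degenerate cases the kernel K of E consists of null vectors, and
   Koszul's formula shows that covariant derivatives are orthogonal to K; hence
   the dual coordinate forms are parallel.  In rank 2, and in the last family
   of rank 1, Ric is a multiple of e^1 e^1; in the other rank 1 families R is a
   multiple of (e^1 /\ e^2)^2; in rank 0 all covariant derivatives lie in the
   totally isotropic derived algebra and R = 0. *)

(** * Coordinates, centrality of brackets and explicit finite sums *)

Section Coordinates.
Context {R : realType}.
Implicit Types (x y z v w : 'rV[R]_6) (a : R) (G : 'M[R]_6).

Lemma crdS x (k : 'I_6) : crd x k.+1 = x 0 k.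
Proof. by rewrite /crd /= inord_val. Qed.

Lemma crd_e (i k : nat) : (0 < k <= 6)%N -> crd (e i : 'rV[R]_6) k = (k == i)%:R.
Proof. by case: k => // k hk; rewrite /crd mxE inordK. Qed.

Lemma crdD x y k : crd (x + y) k = crd x k + crd y k.
Proof. by rewrite /crd mxE. Qed.

Lemma crdB x y k : crd (x - y) k = crd x k - crd y k.
Proof. by rewrite /crd !mxE. Qed.

Lemma crdZ a x k : crd (a *: x) k = a * crd x k.
Proof. by rewrite /crd mxE. Qed.

Lemma crd_bracket x y :
  [/\ crd (bracket x y) 1 = 0, crd (bracket x y) 2 = 0 & crd (bracket x y) 3 = 0].
Proof.
by split; rewrite /bracket crdD crdB !crdZ !crd_e //=; ring.
Qed.

Lemma bracket_central x y z : bracket x (bracket y z) = 0.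
Proof.
rewrite /bracket; have [-> -> ->] := crd_bracket y z.
by rewrite !(mulr0, subr0, scale0r, addr0).
Qed.

Lemma central_bracket x y z : bracket (bracket x y) z = 0.
Proof. by rewrite bracketC bracket_central oppr0. Qed.

Lemma sum6 (F : nat -> R) :
  \sum_(k < 6) F k.+1 = F 1%N + F 2%N + F 3%N + F 4%N + F 5%N + F 6%N.
Proof. by rewrite !big_ord_recl big_ord0 /= /bump /= addr0 !addrA. Qed.

Lemma sum3 (F : nat -> R) : \sum_(k < 3) F k.+1 = F 1%N + F 2%N + F 3%N.
Proof. by rewrite !big_ord_recl big_ord0 /= /bump /= addr0 !addrA. Qed.

Lemma sum33 (F : nat -> nat -> R) : \sum_(i < 3) \sum_(j < 3) F i.+1 j.+1 =
  F 1%N 1%N + F 1%N 2%N + F 1%N 3%N + F 2%N 1%N + F 2%N 2%N + F 2%N 3%N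
  + F 3%N 1%N + F 3%N 2%N + F 3%N 3%N.
Proof.
by rewrite !big_ord_recl !big_ord0 /= /bump /= !addr0 !addrA.
Qed.

Lemma sum66_central (F : nat -> nat -> R) :
  (forall k l, (3 < k)%N \/ (3 < l)%N -> F k l = 0) ->
  \sum_(k < 6) \sum_(l < 6) F k.+1 l.+1 = \sum_(i < 3) \sum_(j < 3) F i.+1 j.+1.
Proof.
move=> F0; rewrite (sum6 (fun k => \sum_(l < 6) F k l.+1)).
rewrite !(sum6 (F _)) sum33.
rewrite !(F0 _ 4) ?(F0 _ 5) ?(F0 _ 6) ?(F0 4) ?(F0 5) ?(F0 6) ?addr0 ?addrA //; by auto.
Qed.

Lemma bformBl G x y z : bform G (x - y) z = bform G x z - bform G y z.
Proof. by rewrite -scaleN1r bformDl bformZl mulN1r. Qed.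

Lemma bformNl G x z : bform G (- x) z = - bform G x z.
Proof. by rewrite -scaleN1r bformZl mulN1r. Qed.

Lemma bformNr G x z : bform G z (- x) = - bform G z x.
Proof. by rewrite -scaleN1r bformZr mulN1r. Qed.

Lemma bform0l G z : bform G 0 z = 0.
Proof. by rewrite -(scale0r 0) bformZl mul0r. Qed.

Lemma koszul_centerl G x y z w :
  koszul G (bracket x y) z w = - bform G (bracket z w) (bracket x y) / 2.
Proof. by rewrite /koszul bracket_central central_bracket !bform0l; ring. Qed.

(** The coefficients are the cross product of the first three coordinates. In this form later
    identities become polynomial ones. *)
Lemma bform_bracket G x y z : bform G (bracket x y) z =
  (crd x 2 * crd y 3 - crd x 3 * crd y 2) * bform G (e 4) z
  + (crd x 3 * crd y 1 - crd x 1 * crd y 3) * bform G (e 5) z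
  + (crd x 1 * crd y 2 - crd x 2 * crd y 1) * bform G (e 6) z.
Proof. by rewrite /bracket bformDl bformBl !bformZl; ring. Qed.

End Coordinates.

Lemma eq_opp0 {R : realType} (t : R) : t = - t -> t = 0.
Proof. by move/eqP; rewrite -addr_eq0 -mulr2n mulrn_eq0 => /eqP. Qed.

(** * Dual basis, curvature and the Ricci tensor of an arbitrary metric *)

Section Metric.
Context {R : realType} (G : 'M[R]_6) (metricG : is_metric G).
Implicit Types (x y z v w : 'rV[R]_6) (a : R).

Let symG : G^T = G. Proof. by case: metricG. Qed.
Let unitG : G \in unitmx. Proof. by case: metricG. Qed.

(** The vector that represents the k-th coordinate form: the trace of T is the sum over k of
    [bform G (T (e k)) (dual k)]. Indices start at 1, as for [crd]. *)
Definition dual (k : nat) : 'rV[R]_6 := row (inord k.-1) (invmx G).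

Lemma dualS (k : 'I_6) : dual k.+1 = row k (invmx G).
Proof. by rewrite /dual /= inord_val. Qed.

Lemma invmx_sym : (invmx G)^T = invmx G.
Proof. by rewrite trmx_inv symG. Qed.

Lemma bform_dual x (k : nat) : bform G x (dual k) = crd x k.
Proof.
by rewrite /bform /dual -mulmxA tr_row invmx_sym colE !mulmxA mulmxK // -colE mxE.
Qed.

Lemma bform_dual_e (i k : nat) : (0 < i <= 6)%N ->
  bform G (dual i) (e k) = (i == k)%:R.
Proof. by move=> hi; rewrite (bformC _ _ symG) bform_dual crd_e. Qed.

Lemma crd_dualC (i j : nat) : crd (dual i) j = crd (dual j) i.
Proof. by rewrite /crd /dual !mxE -[in LHS]invmx_sym mxE. Qed.

Lemma bform_sum_dual x y :
  bform G x y = \sum_(k < 6) bform G x (e k.+1) * bform G y (dual k.+1).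
Proof. by rewrite bformE; apply: eq_bigr => k _; rewrite bform_dual crdS mulrC. Qed.

(** Both sums are the metric trace of [F]: expanding the dual vectors in the basis gives the entries
    of [invmx G], a symmetric matrix. *)
Lemma bilinear_sum_dual (F : 'rV[R]_6 -> 'rV[R]_6 -> R) :
  (forall a x y z, F (a *: x + y) z = a * F x z + F y z) ->
  (forall a x y z, F z (a *: x + y) = a * F z x + F z y) ->
  \sum_(k < 6) F (dual k.+1) (e k.+1) = \sum_(k < 6) F (e k.+1) (dual k.+1).
Proof.
move=> Fl Fr.
have F0l z : F 0 z = 0 by have := Fl (-1) 0 0 z; rewrite scaler0 addr0 mulN1r addNr.
have F0r z : F z 0 = 0 by have := Fr (-1) 0 0 z; rewrite scaler0 addr0 mulN1r addNr.
have El x z : F x z = \sum_(j < 6) x 0 j * F (e j.+1) z.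
  rewrite [in LHS](row_sum_e x); elim/big_ind2: _ => //.
  - by move=> u b v c <- <-; have := Fl 1 b c z; rewrite scale1r mul1r.
  - by move=> k _; rewrite -[_ *: _]addr0 Fl F0l addr0.
have Er x z : F z x = \sum_(j < 6) x 0 j * F z (e j.+1).
  rewrite [in LHS](row_sum_e x); elim/big_ind2: _ => //.
  - by move=> u b v c <- <-; have := Fr 1 b c z; rewrite scale1r mul1r.
  - by move=> k _; rewrite -[_ *: _]addr0 Fr F0r addr0.
under eq_bigr do rewrite El.
under [RHS]eq_bigr do rewrite Er.
rewrite exchange_big; apply: eq_bigr => i _; apply: eq_bigr => j _.
by rewrite !dualS !mxE -[in LHS]invmx_sym mxE.
Qed.

Lemma nablaP : is_levi_civita G (levi_civita G).
Proof. by apply/(levi_civitaP _ metricG). Qed.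

Lemma bform_nabla_skew x y z :
  bform G (levi_civita G x y) z = - bform G y (levi_civita G x z).
Proof. by have [_ _ _ /(_ x y z) /eqP] := nablaP; rewrite addr_eq0 => /eqP. Qed.

(** Metric compatibility moves each outer derivative onto [w]; the derivative along the central
    vector [bracket x y] is given by [koszul_centerl]. *)
Lemma bform_curv x y z w : bform G (curv G x y z) w =
  - bform G (levi_civita G y z) (levi_civita G x w)
  + bform G (levi_civita G x z) (levi_civita G y w)
  + bform G (bracket z w) (bracket x y) / 2.
Proof.
rewrite /curv !bformBl (bform_nabla_skew x (levi_civita G y z))
  (bform_nabla_skew y (levi_civita G x z)) opprK.
by rewrite (bform_levi_civita (bracket x y)) // koszul_centerl mulNr opprK.
Qed.

Lemma e_delta (k : 'I_6) : delta_mx 0 k = e k.+1 :> 'rV[R]_6.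
Proof. by apply/rowP => j; rewrite !mxE eqSS eqxx. Qed.

Lemma ricci_trace x y :
  ricci G x y = \sum_(k < 6) bform G (curv G (e k.+1) x y) (dual k.+1).
Proof.
by apply: eq_bigr => k _; rewrite mxE e_delta bform_dual crdS.
Qed.

(* Unimodularity: the trace of ad v vanishes. *)
Lemma sum_nabla_dual v :
  \sum_(k < 6) bform G v (levi_civita G (e k.+1) (dual k.+1)) = 0.
Proof.
have br0 (k : 'I_6) : bform G (bracket (e k.+1) v) (dual k.+1) = 0.
  rewrite bform_dual.
  case: k => [[|[|[|[|[|[|k]]]]]] hk] //=;
  by rewrite /bracket crdD crdB !crdZ !crd_e //=; ring.
(* The metric trace of an antisymmetric form equals its own opposite. *)
have anti : \sum_(k < 6) bform G (bracket (e k.+1) (dual k.+1)) v = 0.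
  apply: eq_opp0; rewrite -{1}(bilinear_sum_dual (F := fun x y => bform G (bracket x y) v)).
  - by rewrite -sumrN; apply: eq_bigr => k _; rewrite -bformNl -bracketC.
  - by move=> *; rewrite bracket_linl bformDl bformZl.
  - by move=> *; rewrite bracket_linr bformDl bformZl.
have tr0 : \sum_(k < 6) bform G (bracket (dual k.+1) v) (e k.+1) = 0.
  rewrite (bilinear_sum_dual (F := fun x y => bform G (bracket x v) y)) ?big1 //.
  - by move=> *; rewrite bracket_linl bformDl bformZl.
  - by move=> *; rewrite bformDr bformZr.
under eq_bigr => k _ do rewrite bformC // bform_levi_civita // /koszul
  (bracketC v) bformNl br0 oppr0 addr0.
by rewrite -mulr_suml sumrB anti tr0 subr0 mul0r.
Qed.

Lemma sum_sym_antisym n (s t : 'I_n -> 'I_n -> R) :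
  (forall k l, s k l = s l k) -> (forall k l, t k l = - t l k) ->
  \sum_(k < n) \sum_(l < n) s k l * t k l = 0.
Proof.
move=> ss tt; apply: eq_opp0; rewrite {1}exchange_big -sumrN; apply: eq_bigr => k _.
by rewrite -sumrN; apply: eq_bigr => l _; rewrite ss tt mulrN.
Qed.

(** Either the index [l.+1] exceeds 3 and the basis vector is central, or it is at most 3 and this
    coordinate of a bracket vanishes. *)
Lemma bform_bracket_crd (k l : 'I_6) x z v :
  bform G (bracket (e k.+1) (e l.+1)) x * crd (bracket z v) l.+1 = 0.
Proof.
have [h1 h2 h3] := crd_bracket z v.
rewrite bform_bracket !crd_e //.
by case: l => [[|[|[|[|[|[|l]]]]]] hl] //=; rewrite ?h1 ?h2 ?h3; ring.
Qed.

(** In the indices k, l the Koszul expression of the first factor is the symmetric [s] minus a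
    bracket term, up to a factor 2. The second factor is antisymmetric by metric compatibility, so
    [s] contributes nothing; two of the three products left vanish by [bform_bracket_crd]. *)
Lemma sum_nabla_nabla x y :
  \sum_(k < 6) bform G (levi_civita G (e k.+1) y) (levi_civita G x (dual k.+1)) =
  \sum_(k < 6) \sum_(l < 6) bform G (bracket (e k.+1) (e l.+1)) y
                           * bform G (bracket (dual k.+1) (dual l.+1)) x / 4.
Proof.
under eq_bigr => k _ do rewrite bform_sum_dual.
pose s (k l : 'I_6) := bform G (bracket (e k.+1) y) (e l.+1)
  + bform G (bracket (e l.+1) y) (e k.+1).
pose t (k l : 'I_6) := koszul G x (dual k.+1) (dual l.+1) / 2.
have ss k l : s k l = s l k by rewrite /s addrC.
have tt k l : t k l = - t l k.
  rewrite /t /koszul (bracketC (dual l.+1) (dual k.+1)) (bracketC (dual l.+1) x).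
  by rewrite (bracketC (dual k.+1) x) !bformNl; ring.
rewrite -[RHS]add0r -[X in X + _](sum_sym_antisym ss tt) -big_split /=.
apply: eq_bigr => k _; rewrite -big_split; apply: eq_bigr => l _ /=.
rewrite !bform_levi_civita // /s /t {1}/koszul.
have b1 : bform G (bracket (e k.+1) (e l.+1)) y * bform G (bracket x (dual k.+1)) (dual l.+1) = 0.
  by rewrite bform_dual bform_bracket_crd.
have b2 : bform G (bracket (e k.+1) (e l.+1)) y * bform G (bracket x (dual l.+1)) (dual k.+1) = 0.
  by rewrite bracketC bformNl bform_dual mulNr bform_bracket_crd oppr0.
rewrite /koszul (bracketC y) (bracketC (e l.+1) (e k.+1)) (bracketC (dual l.+1) x) !bformNl.
move: b1 b2; set u := bform G (bracket (e k.+1) (e l.+1)) y.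
set b := bform G _ (dual l.+1); set c := bform G (bracket x (dual l.+1)) _ => b1 b2.
set d := bform G (bracket (dual k.+1) _) _.
set f := bform G _ (e l.+1); set g := bform G _ (e k.+1).
(* The added terms are zero and complete [d] to the Koszul expression behind [t]. *)
have -> : u * d / 4 = u * d / 4 - (u * b) / 4 + (u * c) / 4 by rewrite b1 b2; ring.
by field.
Qed.

(** Trace of [bform_curv]: its first term drops out by [sum_nabla_dual], its second is
    [sum_nabla_nabla]. *)
Lemma ricciE x y : ricci G x y =
  - (\sum_(k < 6) bform G (bracket x (e k.+1)) (bracket y (dual k.+1))) / 2
  + \sum_(k < 6) \sum_(l < 6) bform G (bracket (e k.+1) (e l.+1)) y
                           * bform G (bracket (dual k.+1) (dual l.+1)) x / 4.
Proof.
rewrite ricci_trace; under eq_bigr => k _ do rewrite bform_curv.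
rewrite !big_split /= sumrN sum_nabla_dual oppr0 add0r sum_nabla_nabla addrC.
congr (_ + _); rewrite mulNr mulr_suml -sumrN; apply: eq_bigr => k _.
by rewrite (bracketC _ x) bformNr mulNr bformC.
Qed.

(* Indices run over 1, 2, 3, and [next3] permutes them cyclically. *)
Definition next3 (i : nat) : nat := if i is 3 then 1 else i.+1.

(* Polarized cofactor: [mcof P P] is twice the cofactor matrix of P. *)
Definition mcof (P Q : nat -> nat -> R) (i j : nat) : R :=
  P (next3 i) (next3 j) * Q (next3 (next3 i)) (next3 (next3 j))
  + P (next3 (next3 i)) (next3 (next3 j)) * Q (next3 i) (next3 j)
  - P (next3 i) (next3 (next3 j)) * Q (next3 (next3 i)) (next3 j)
  - P (next3 (next3 i)) (next3 j) * Q (next3 i) (next3 (next3 j)).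

(** For indices from 1 to 3 these are the entries of the block P; [derivedg] below gives those of
    E. *)
Definition pinv (i j : nat) : R := crd (dual i) j.

Definition derivedg (i j : nat) : R := bform G (e i.+3) (e j.+3).

(** Contracting two cross products with two symmetric matrices yields polarized cofactors: of P and
    E in the first sum of [ricciE], of P with itself in the second, where the central indices
    contribute nothing. *)
Lemma ricci_cofactor x y : ricci G x y =
  - (\sum_(i < 3) \sum_(j < 3) crd x i.+1 * crd y j.+1 * mcof pinv derivedg i.+1 j.+1) / 2
  + (\sum_(i < 3) \sum_(j < 3) bform G (e i.+4) x * bform G (e j.+4) y
       * mcof pinv pinv i.+1 j.+1) / 4.
Proof.
rewrite ricciE; congr (- _ / 2 + _).
  rewrite (sum6 (fun k => bform G (bracket x (e k)) (bracket y (dual k)))).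
  rewrite (sum33 (fun i j => crd x i * crd y j * mcof pinv derivedg i j)).
  have E k z w : bform G (e k) (bracket z w) = bform G (bracket z w) (e k) by rewrite bformC.
  rewrite !bform_bracket !crd_e // !E !bform_bracket.
  rewrite /mcof /next3 /pinv /derivedg.
  rewrite (bformC (e 5) (e 4)) // (bformC (e 6) (e 4)) // (bformC (e 6) (e 5)) //.
  rewrite (crd_dualC 2 1) (crd_dualC 3 1) (crd_dualC 3 2).
  by rewrite /=; ring.
rewrite (sum33 (fun i j => bform G (e i.+3) x * bform G (e j.+3) y * mcof pinv pinv i j)).
rewrite (sum66_central (F := fun k l => bform G (bracket (e k) (e l)) y
                           * bform G (bracket (dual k) (dual l)) x / 4)); last first.
  move=> k l hkl; rewrite bform_bracket !crd_e //.
  by case: hkl; [case: k => [|[|[|[|k]]]] | case: l => [|[|[|[|l]]]]] => //= _; ring.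
rewrite (sum33 (fun k l => bform G (bracket (e k) (e l)) y
                           * bform G (bracket (dual k) (dual l)) x / 4)).
rewrite !bform_bracket !crd_e // /mcof /next3 /pinv.
rewrite (crd_dualC 2 1) (crd_dualC 3 1) (crd_dualC 3 2).
by rewrite /=; ring.
Qed.
End Metric.

(** * Einstein metrics, and metrics with non-degenerate derived algebra *)

Section Einstein.
Context {R : realType} (G : 'M[R]_6) (metricG : is_metric G).

Let symG : G^T = G. Proof. by case: metricG. Qed.

(** The first sum of [ricci_cofactor] vanishes on a central vector, and the products with the dual
    vector are Kronecker symbols. This computes the entries of E cof(P), up to a factor 2. *)
Lemma ricci_dual_central (i j : nat) : (0 < i <= 3)%N -> (0 < j <= 3)%N ->
  ricci G (e i.+3) (dual G j.+3) =
  (\sum_(k < 3) derivedg G i k.+1 * mcof (pinv G) (pinv G) k.+1 j) / 4.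
Proof.
move=> hi hj; rewrite ricci_cofactor // (sum33 (fun k l => _ k * _ l * mcof _ _ k l)).
rewrite (sum33 (fun k l => bform G (e k.+3) _ * bform G (e l.+3) _ * mcof _ _ k l)).
rewrite (sum3 (fun k => derivedg G i k * mcof _ _ k j)) /derivedg !(bformC (e i.+3)) //.
case: i hi => [|[|[|[|i]]]] // _; case: j hj => [|[|[|[|j]]]] // _;
by rewrite !bform_dual // !crd_e //=; ring.
Qed.

(** Here the second sum vanishes, since these dual vectors are orthogonal to the derived algebra.
    Contracting P with [mcof] of P and E polarizes the determinant, so it equals the contraction of
    E with [mcof] of P and P. *)
Lemma sum_ricci_dual_noncentral :
  ricci G (e 1) (dual G 1) + ricci G (e 2) (dual G 2) + ricci G (e 3) (dual G 3)
  = - (\sum_(k < 3) \sum_(l < 3) derivedg G k.+1 l.+1 * mcof (pinv G) (pinv G) l.+1 k.+1) / 2.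
Proof.
rewrite !ricci_cofactor // !(sum33 (fun k l => _ k * _ l * mcof _ _ k l)).
rewrite !(sum33 (fun k l => bform G (e k.+3) _ * bform G (e l.+3) _ * mcof _ _ k l)).
rewrite (sum33 (fun k l => derivedg G k l * mcof _ _ l k)).
rewrite !bform_dual // !crd_e // /mcof /next3 /pinv /derivedg.
rewrite (bformC (e 5) (e 4)) // (bformC (e 6) (e 4)) // (bformC (e 6) (e 5)) //.
rewrite (crd_dualC metricG 2 1) (crd_dualC metricG 3 1) (crd_dualC metricG 3 2).
by rewrite /=; ring.
Qed.

Lemma einstein_ricci_flat : einstein G <-> ricci_flat G.
Proof.
split=> [[c Gc]|G0]; last by exists 0 => x y; rewrite G0 mul0r.
suff c0 : c = 0 by move=> x y; rewrite Gc c0 mul0r.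
have := sum_ricci_dual_noncentral.
have h4 := @ricci_dual_central 1 1 isT isT.
have h5 := @ricci_dual_central 2 2 isT isT.
have h6 := @ricci_dual_central 3 3 isT isT.
rewrite (sum33 (fun k l => derivedg G k l * mcof _ _ l k)).
move: h4 h5 h6; rewrite !Gc !bform_dual // !crd_e //= !mulr1.
rewrite !(sum3 (fun k => derivedg G _ k * mcof _ _ k _)).
by move=> h4 h5 h6 h; lra.
Qed.

Lemma derived_gramE (i j : 'I_3) : derived_gram G i j = derivedg G i.+1 j.+1.
Proof.
have re (k : 'I_3) : e k.+4 = row k derived_basis :> 'rV[R]_6 by rewrite rowK addn4.
rewrite /derivedg /derived_gram /bform !re -row_mul tr_row [LHS]mxE [RHS]mxE.
by apply: eq_bigr => k _; rewrite [row _ _ _ _]mxE [col _ _ _ _]mxE.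
Qed.

(* The Schur complement of E in G is the inverse of the block P of G^-1. *)
Lemma derived_nondegenerate_pinv : derived_nondegenerate G ->
  (\matrix_(i < 3, j < 3) pinv G i.+1 j.+1) \in unitmx.
Proof.
have [_ unitG] := metricG.
pose G' : 'M[R]_(3 + 3) := G; pose H : 'M[R]_(3 + 3) := invmx G.
have defG : G = triple (ulsubmx G') (ursubmx G') (drsubmx G').
  by rewrite /triple trmx_ursub [G'^T]symG submxK.
move=> ndG; have unitE : drsubmx G' \in unitmx.
  by move: ndG; rewrite /derived_nondegenerate defG derived_gram_triple.
have : block_mx (ulsubmx G') (ursubmx G') (dlsubmx G') (drsubmx G')
    *m block_mx (ulsubmx H) (ursubmx H) (dlsubmx H) (drsubmx H) = 1%:M.
  by rewrite !submxK; exact: mulmxV.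
rewrite mulmx_block scalar_mx_block => /eq_block_mx [hul _ hdl _].
have defQ : dlsubmx H = - (invmx (drsubmx G') *m (dlsubmx G' *m ulsubmx H)).
  apply/eqP; rewrite -addr_eq0 -[dlsubmx H](mulKmx unitE) -mulmxDr addrC hdl mulmx0.
  by [].
have -> : \matrix_(i < 3, j < 3) pinv G i.+1 j.+1 = ulsubmx H.
  apply/matrixP => i j; rewrite mxE /pinv /crd /dual !mxE; congr (fun_of_matrix _ _ _);
  by apply: val_inj; rewrite /= inordK // (leq_trans (ltn_ord _)).
move: hul; rewrite defQ mulmxN !mulmxA -mulmxBl => /mulmx1_unit [_].
by [].
Qed.

(** Ricci-flatness gives E cof(P) = 0, hence cof(P) = 0, which is impossible for an invertible
    matrix of size 3. *)
Lemma derived_nondegenerate_not_ricci_flat : derived_nondegenerate G -> ~ ricci_flat G.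
Proof.
move=> ndG G0.
pose C := \matrix_(i < 3, j < 3) mcof (pinv G) (pinv G) i.+1 j.+1.
have C0 : C = 0.
  rewrite -[C](mulKmx ndG) -[RHS](mulmx0 _ (invmx (derived_gram G))); congr (_ *m _).
  apply/matrixP => i j; rewrite [LHS]mxE [RHS]mxE.
  have := ricci_dual_central (ltn_ord i : (0 < i.+1 <= 3)%N) (ltn_ord j : (0 < j.+1 <= 3)%N).
  rewrite G0 => /esym /eqP; rewrite mulf_eq0 invr_eq0 pnatr_eq0 orbF => /eqP EC0.
  rewrite -[RHS]EC0.
  by apply: eq_bigr => k _; rewrite derived_gramE [C _ _]mxE.
have /mulVmx := derived_nondegenerate_pinv ndG.
set W := invmx _ => WP.
have c0 (i j : 'I_3) : mcof (pinv G) (pinv G) i.+1 j.+1 = 0.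
  by move/matrixP/(_ i j): C0; rewrite !mxE.
have wp (i j : 'I_3) : \sum_(k < 3) W i k * pinv G k.+1 j.+1 = (i == j)%:R.
  by move/matrixP/(_ i j): WP; rewrite !mxE => <-; apply: eq_bigr => k _; rewrite !mxE.
pose o (k : nat) : 'I_3 := inord k.
have ok k : (k < 3)%N -> nat_of_ord (o k) = k by move=> ?; rewrite /o inordK.
have := wp (o 0%N) (o 0%N); have := wp (o 0%N) (o 1%N).
have := wp (o 1%N) (o 0%N); have := wp (o 1%N) (o 1%N).
have := c0 (o 0%N) (o 2%N); have := c0 (o 1%N) (o 2%N); have := c0 (o 2%N) (o 2%N).
rewrite -!val_eqE /= !ok // !big_ord_recl !big_ord0 /= /bump !add1n /mcof /next3.
move: (W _ _) (W _ _) (W _ _) (W _ _) (W _ _) (W _ _) => w1 w2 w3 w4 w5 w6.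
move=> m1 m2 m3 h11 h10 h01 h00.
(* Cauchy-Binet for the first two rows of [W] and the first two columns of P: the minors of P that
   occur are the cofactors of its third column, all zero, while the corresponding minor of the
   identity is 1. The multipliers below are the minors of [W], up to sign. *)
have d1 := f_equal2 *%R h00 h11; have d2 := f_equal2 *%R h01 h10.
have l1 := congr1 (fun t => (w3 * w5 - w2 * w6) * t) m1.
have l2 := congr1 (fun t => (w3 * w4 - w1 * w6) * t) m2.
have l3 := congr1 (fun t => (w2 * w4 - w1 * w5) * t) m3.
move: d1 d2 l1 l2 l3 => /= d1 d2 l1 l2 l3.
have /eqP : (1 : R) = 0 by clear C0 WP; lra.
by rewrite oner_eq0.
Qed.

End Einstein.

(** * Metrics given by block matrices *)

Section Triples.
Context {R : realType}.
Implicit Types (x y z w : 'rV[R]_6) (S M E : 'M[R]_3).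

Lemma crd_lshift x (i : 'I_3) : x 0 (lshift 3 i : 'I_(3 + 3)) = crd x i.+1.
Proof. by rewrite -crdS. Qed.

Lemma crd_rshift x (i : 'I_3) : x 0 (rshift 3 i : 'I_(3 + 3)) = crd x i.+4.
Proof. by rewrite -crdS /= add3n. Qed.

Lemma bform_triple S M E x y : bform (triple S M E) x y =
  \sum_(i < 3) \sum_(j < 3)
    (crd x i.+1 * S i j * crd y j.+1 + crd x i.+1 * M i j * crd y j.+4
     + crd x j.+4 * M i j * crd y i.+1 + crd x i.+4 * E i j * crd y j.+4).
Proof.
pose x' : 'rV[R]_(3 + 3) := x; pose y' : 'rV[R]_(3 + 3) := y.
have -> : bform (triple S M E) x y =
   (row_mx (lsubmx x') (rsubmx x') *m block_mx S M M^T E *m (row_mx (lsubmx y') (rsubmx y'))^T) 0 0.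
  by rewrite !hsubmxK.
have F (u v : 'rV[R]_3) (A : 'M[R]_3) :
    (u *m A *m v^T) 0 0 = \sum_(i < 3) \sum_(j < 3) u 0 i * A i j * v 0 j.
  rewrite mxE exchange_big; apply: eq_bigr => j _; rewrite !mxE mulr_suml.
  by apply: eq_bigr => i _.
have D (u v : 'M[R]_1) : (u + v) 0 0 = u 0 0 + v 0 0 by rewrite mxE.
rewrite mul_row_block tr_row_mx mul_row_col !mulmxDl !D !F.
rewrite [X in _ + X + _]exchange_big -!big_split; apply: eq_bigr => i _ /=.
rewrite -!big_split; apply: eq_bigr => j _ /=; rewrite !mxE.
by rewrite !crd_lshift !crd_rshift; ring.
Qed.

Lemma bform_triple3 s m t x y : bform (triple (mx3 s) (mx3 m) (mx3 t)) x y =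
  \sum_(i < 3) \sum_(j < 3)
    (crd x i.+1 * (nth [::] s i)`_j * crd y j.+1 + crd x i.+1 * (nth [::] m i)`_j * crd y j.+4
     + crd x j.+4 * (nth [::] m i)`_j * crd y i.+1 + crd x i.+4 * (nth [::] t i)`_j * crd y j.+4).
Proof.
rewrite bform_triple; apply: eq_bigr => i _; apply: eq_bigr => j _.
by rewrite !mxE.
Qed.

Lemma scale_diag3 (c a b d : R) : c *: diag3 a b d = diag3 (c * a) (c * b) (c * d).
Proof.
apply/matrixP => i j; rewrite !mxE.
by case: i => [[|[|[|i]]] hi] //; case: j => [[|[|[|j]]] hj] //=; rewrite mulr0.
Qed.

(** A common family for the forms (b), (f), (g) with each matrix E of the rank 2 lists. *)
Definition rank2_gram (a b d e1 e2 : R) : 'M[R]_6 :=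
  triple (mx3 [:: [:: 0; 0; 0]; [:: 0; a; b]; [:: 0; b; d]]) (diag3 1 0 0) (diag3 0 e1 e2).

Lemma bform_rank2 a b d e1 e2 x y : bform (rank2_gram a b d e1 e2) x y =
  crd x 1 * crd y 4 + crd x 4 * crd y 1 + a * crd x 2 * crd y 2
  + b * (crd x 2 * crd y 3 + crd x 3 * crd y 2) + d * crd x 3 * crd y 3
  + e1 * crd x 5 * crd y 5 + e2 * crd x 6 * crd y 6.
Proof.
by rewrite bform_triple3 !big_ord_recl !big_ord0 /= /bump !add1n /=; ring.
Qed.

(** * Derived algebra of rank 2 *)

Section Rank2.
Variables a b d e1 e2 : R.
Let G := rank2_gram a b d e1 e2.
Hypothesis metricG : is_metric G.

(** The product with [e 4] reads off the first coordinate. It vanishes on covariant derivatives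
    because [e 4] is central and orthogonal to all brackets. *)
Lemma nabla_rank2_crd1 w x : crd (levi_civita G w x) 1 = 0.
Proof.
have [_ unitG] := metricG.
have := bform_levi_civita w x (e 4) unitG; rewrite bform_rank2 /koszul !bform_bracket !bform_rank2.
by rewrite !crd_e //= => h; lra.
Qed.

Lemma ricci_rank2 : exists2 r : R,
  forall x y, ricci G x y = r * crd x 1 * crd y 1 & r = 0 <-> a * e1 + d * e2 = 1.
Proof.
have hG i k : (0 < i <= 3)%N -> bform G (dual G i) (e k) = (i == k)%:R.
  by move=> hi; rewrite (bform_dual_e metricG) //; case: i hi => [|[|[|[|i]]]].
(* P has zero first row and column; [p2] and [p3] say that its remaining block inverts the block of
   S with entries a, b, b, d. *)
have p0 i : (0 < i <= 3)%N -> pinv G i 1 = 0.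
  move=> hi; have := hG i 4%N hi; rewrite bform_rank2 !crd_e //= /pinv.
  have /negbTE -> : (i != 4)%N by case: i hi => [|[|[|[|i]]]].
  by move=> /= h; lra.
have p2 i : (0 < i <= 3)%N -> a * pinv G i 2 + b * pinv G i 3 = (i == 2)%:R.
  move=> hi; have := hG i 2%N hi; rewrite bform_rank2 !crd_e //= /pinv.
  by move=> h; lra.
have p3 i : (0 < i <= 3)%N -> b * pinv G i 2 + d * pinv G i 3 = (i == 3)%:R.
  move=> hi; have := hG i 3%N hi; rewrite bform_rank2 !crd_e //= /pinv.
  by move=> h; lra.
have := p2 2%N isT; have := p2 3%N isT; have := p3 2%N isT; have := p3 3%N isT.
have := crd_dualC metricG 3 2; rewrite -!/(pinv _ _ _) /=.
set p22 := pinv G 2 2; set p23 := pinv G 2 3; set p33 := pinv G 3 3 => -> q33 q23 q32 q22.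
exists ((p22 * p33 - p23 ^+ 2 - e2 * p22 - e1 * p33) / 2).
  move=> x y; rewrite ricci_cofactor //.
  rewrite (sum33 (fun i j => crd x i * crd y j * mcof _ _ i j)).
  rewrite (sum33 (fun i j => bform G (e i.+3) x * bform G (e j.+3) y * mcof _ _ i j)).
  have r1 i : (0 < i <= 3)%N -> pinv G 1 i = 0.
    by move=> hi; rewrite /pinv (crd_dualC metricG) -/(pinv _ _ _) p0.
  have r32 : pinv G 3 2 = p23 by rewrite /pinv (crd_dualC metricG).
  rewrite /mcof /next3 !r1 // !p0 // r32 -/p22 -/p23 -/p33 /derivedg !bform_rank2 !crd_e //=.
  by field.
have D1 : (a * d - b ^+ 2) * (p22 * p33 - p23 ^+ 2) = 1.
  have h := f_equal2 *%R q22 q33; have h' := f_equal2 *%R q23 q32.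
  by move: h h' => /= h h'; lra.
have D0 : a * d - b ^+ 2 != 0.
  by apply/eqP => D0; move/eqP: D1; rewrite D0 mul0r eq_sym oner_eq0.
have D2 : (a * d - b ^+ 2) * p22 = d.
  have h := congr1 (fun t => d * t) q22; have h' := congr1 (fun t => b * t) q23.
  by move: h h' => /= h h'; lra.
have D3 : (a * d - b ^+ 2) * p33 = a.
  have h := congr1 (fun t => a * t) q33; have h' := congr1 (fun t => b * t) q32.
  by move: h h' => /= h h'; lra.
(* Multiplying twice the coefficient [r] by the determinant of that block of S removes all entries
   of P. *)
have K : (a * d - b ^+ 2) * (p22 * p33 - p23 ^+ 2 - e2 * p22 - e1 * p33) = 1 - (a * e1 + d * e2).
  have h := congr1 (fun t => e2 * t) D2; have h' := congr1 (fun t => e1 * t) D3.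
  by move: h h' => /= h h'; lra.
split=> [r0|h].
  have {}r0 : p22 * p33 - p23 ^+ 2 - e2 * p22 - e1 * p33 = 0 by lra.
  by move: K; rewrite r0 mulr0; lra.
move/eqP: K; rewrite h subrr mulf_eq0 (negbTE D0) /= => /eqP ->.
by rewrite mul0r.
Qed.

Lemma ricci_parallel_rank2 : ricci_parallel G.
Proof.
have [r ricr _] := ricci_rank2.
by move=> w x y; rewrite /nabla_ricci !ricr !nabla_rank2_crd1; ring.
Qed.

Lemma ricci_flat_rank2 : ricci_flat G <-> a * e1 + d * e2 = 1.
Proof.
have [r ricr r0] := ricci_rank2; rewrite -r0; split=> [G0|rz x y]; last by rewrite ricr rz !mul0r.
by have := G0 (e 1) (e 1); rewrite ricr !crd_e //= !mulr1.
Qed.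

End Rank2.

End Triples.

(** * Rank 1: the locally symmetric and flat families *)

Section Rank1.
Context {R : realType}.
Implicit Types (x y z w : 'rV[R]_6).

Definition rank1_gram (s m11 m12 m21 m22 : R) : 'M[R]_6 :=
  triple (diag3 0 0 s) (mx3 [:: [:: m11; m12; 0]; [:: m21; m22; 0]; [:: 0; 0; 0]]) E10.

Lemma bform_rank1 s m11 m12 m21 m22 x y : bform (rank1_gram s m11 m12 m21 m22) x y =
  m11 * (crd x 1 * crd y 4 + crd x 4 * crd y 1) + m12 * (crd x 1 * crd y 5 + crd x 5 * crd y 1)
  + m21 * (crd x 2 * crd y 4 + crd x 4 * crd y 2) + m22 * (crd x 2 * crd y 5 + crd x 5 * crd y 2)
  + s * crd x 3 * crd y 3 + crd x 6 * crd y 6.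
Proof. by rewrite bform_triple3 !big_ord_recl !big_ord0 /= /bump !add1n /=; ring. Qed.

Variables s m11 m12 m21 m22 : R.
Let G := rank1_gram s m11 m12 m21 m22.
Hypothesis metricG : is_metric G.
Hypothesis ss1 : s * s = 1.

Lemma rank1_crd12_eq0 u : bform G u (e 4) = 0 -> bform G u (e 5) = 0 ->
  crd u 1 = 0 /\ crd u 2 = 0.
Proof.
have [symG _] := metricG.
have hG := bform_dual_e metricG.
have := hG 4%N 4%N isT; have := hG 4%N 5%N isT; have := hG 5%N 4%N isT; have := hG 5%N 5%N isT.
rewrite !bform_rank1 !crd_e //= => h55 h54 h45 h44 h4 h5.
have D0 : m11 * m22 - m12 * m21 != 0.
  (* Coordinates 1 and 2 of [dual G 4] and [dual G 5] invert the leading block of M, so the two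
     determinants multiply to 1. *)
  apply/eqP => D0; have /eqP : (1 : R) = 0; last by rewrite oner_eq0.
  have h := f_equal2 *%R h55 h44; have h' := f_equal2 *%R h45 h54.
  have h'' := congr1 (fun t => (crd (dual G 4) 1 * crd (dual G 5) 2
                                - crd (dual G 4) 2 * crd (dual G 5) 1) * t) D0.
  by move: h h' h'' => /= h h' h''; lra.
split; apply: (mulfI D0).
  have h := congr1 (fun t => m22 * t) h4; have h' := congr1 (fun t => m21 * t) h5.
  by move: h h' => /= h h'; lra.
have h := congr1 (fun t => m12 * t) h4; have h' := congr1 (fun t => m11 * t) h5.
by move: h h' => /= h h'; lra.
Qed.

Lemma nabla_rank1_crd12 w x : crd (levi_civita G w x) 1 = 0 /\ crd (levi_civita G w x) 2 = 0.
Proof.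
have [_ unitG] := metricG.
by apply: rank1_crd12_eq0;
  rewrite (bform_levi_civita _ _ _ unitG) /koszul !bform_bracket !bform_rank1 !crd_e //=; ring.
Qed.

(** Covariant derivatives lie in the span of e_3, ..., e_6, where only e_3 and e_6 contribute to the
    metric. Their coordinates there are recovered from [koszul], using that [s] is its own
    inverse. *)
Lemma bform_nabla_rank1 x y z w : bform G (levi_civita G x y) (levi_civita G z w) =
  s * koszul G x y (e 3) * koszul G z w (e 3) + koszul G x y (e 6) * koszul G z w (e 6).
Proof.
have [_ unitG] := metricG; rewrite -!(bform_levi_civita _ _ _ unitG) !bform_rank1 !crd_e //=.
have [-> ->] := nabla_rank1_crd12 x y; have [-> ->] := nabla_rank1_crd12 z w.
move: (levi_civita G x y) (levi_civita G z w) => u v.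
transitivity (s * s * (s * crd u 3 * crd v 3) + crd u 6 * crd v 6); last by ring.
by rewrite ss1; ring.
Qed.

(** The first summand is -s times the determinant of the quadratic form [koszul G x x (e 3)] in the
    first two coordinates; the constant collects the contributions of e_6. *)
Definition rank1_curvature : R := s * (m12 * m21 + (m22 - m11) ^+ 2 / 4) - 3 / 4.

(* The null plane spanned by e4 and e5 consists of parallel vectors, so the
   curvature descends to a multiple of the square of the 2-form e^1 /\ e^2. *)
Lemma bform_curv_rank1 x y z w : bform G (curv G x y z) w =
  - rank1_curvature * (crd x 1 * crd y 2 - crd x 2 * crd y 1)
                    * (crd z 1 * crd w 2 - crd z 2 * crd w 1).
Proof.
have [symG unitG] := metricG.
have bC k u v : bform G (e k) (bracket u v) = bform G (bracket u v) (e k) by rewrite bformC.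
rewrite bform_curv // !bform_nabla_rank1 /koszul !bform_bracket !bC !bform_bracket.
rewrite !bform_rank1 !crd_e //= /rank1_curvature.
by field.
Qed.

Lemma flat_rank1 : rank1_curvature = 0 -> flat G.
Proof.
have [symG unitG] := metricG.
move=> k0 x y z; apply: (bform_inj unitG) => w.
by rewrite bform_curv_rank1 k0 bform0l; ring.
Qed.

(** The forms e^1 and e^2 are parallel by [nabla_rank1_crd12], hence so is a multiple of the square
    of e^1 /\ e^2. *)
Lemma locally_symmetric_rank1 : locally_symmetric G.
Proof.
have [symG unitG] := metricG.
move=> w x y z; apply: (bform_inj unitG) => v.
rewrite /nabla_curv 3!bformBl (bform_nabla_skew metricG w (curv G x y z)) !bform_curv_rank1 bform0l.
have [-> ->] := nabla_rank1_crd12 w x; have [-> ->] := nabla_rank1_crd12 w y.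
have [-> ->] := nabla_rank1_crd12 w z; have [-> ->] := nabla_rank1_crd12 w v.
by ring.
Qed.

(** The vectors dual to e^1 and e^2 have zero coordinates 1 and 2, so every term of the trace
    vanishes. *)
Lemma ricci_flat_rank1 : ricci_flat G.
Proof.
have [symG unitG] := metricG.
have hG := bform_dual_e metricG.
move=> x y; rewrite (ricci_trace metricG) (sum6 (fun k => bform G (curv G (e k) x y) (dual G k))).
rewrite !bform_curv_rank1 !crd_e //=.
have [-> ->] := rank1_crd12_eq0 (hG 1%N 4%N isT) (hG 1%N 5%N isT).
have [-> ->] := rank1_crd12_eq0 (hG 2%N 4%N isT) (hG 2%N 5%N isT).
by ring.
Qed.

End Rank1.

(** * Rank 1: the remaining Ricci-parallel family *)

Section Rank1RicciParallel.
Context {R : realType}.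
Implicit Types (x y z w : 'rV[R]_6).

Definition rank1_shear_gram (s t l : R) : 'M[R]_6 :=
  triple (diag3 0 0 s) (mx3 [:: [:: 0; l; 0]; [:: 1; 0; 0]; [:: 1; 0; 0]]) (diag3 0 0 t).

Lemma bform_rank1_shear s t l x y : bform (rank1_shear_gram s t l) x y =
  l * (crd x 1 * crd y 5 + crd x 5 * crd y 1) + crd x 2 * crd y 4 + crd x 4 * crd y 2
  + crd x 3 * crd y 4 + crd x 4 * crd y 3 + s * crd x 3 * crd y 3 + t * crd x 6 * crd y 6.
Proof. by rewrite bform_triple3 !big_ord_recl !big_ord0 /= /bump !add1n /=; ring. Qed.

(** The product with [e 5] is l times the first coordinate, so e^1 is parallel. Orthogonality to
    [e 4] makes P a multiple of the square of (0, 1, -1), so cof(P) = 0 and only the term of P # E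
    in e^1 e^1 is left. *)
Lemma ricci_parallel_rank1_shear s t l :
  is_metric (rank1_shear_gram s t l) -> ricci_parallel (rank1_shear_gram s t l).
Proof.
set G := rank1_shear_gram s t l => metricG; have [symG unitG] := metricG.
have hG := bform_dual_e metricG.
have l0 : l != 0.
  apply/eqP => l0; have := hG 5%N 5%N isT; rewrite bform_rank1_shear !crd_e // l0 /= => h.
  by have /eqP := oner_neq0 R; apply; lra.
have crd1 u : bform G u (e 5) = 0 -> crd u 1 = 0.
  by rewrite bform_rank1_shear !crd_e //= => h; apply: (mulfI l0); lra.
have nabla1 w x : crd (levi_civita G w x) 1 = 0.
  apply: crd1; rewrite (bform_levi_civita _ _ _ unitG) /koszul !bform_bracket.
  rewrite !bform_rank1_shear !crd_e //=.
  by ring.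
have p1 i : (0 < i <= 3)%N -> pinv G i 1 = 0.
  by move=> hi; apply: crd1; rewrite hG; case: i hi => [|[|[|[|i]]]].
have p3 i : (0 < i <= 3)%N -> pinv G i 3 = - pinv G i 2.
  move=> hi; have : bform G (dual G i) (e 4) = 0 by rewrite hG; case: i hi => [|[|[|[|i]]]].
  by rewrite bform_rank1_shear !crd_e //= -!/(pinv _ _ _) => h; lra.
have ricE x y : ricci G x y = - (t * pinv G 2 2 / 2) * crd x 1 * crd y 1.
  rewrite ricci_cofactor //.
  rewrite (sum33 (fun i j => crd x i * crd y j * mcof _ _ i j)).
  rewrite (sum33 (fun i j => bform G (e i.+3) x * bform G (e j.+3) y * mcof _ _ i j)).
  have p12 : pinv G 1 2 = 0 by rewrite /pinv (crd_dualC metricG) -/(pinv _ _ _) p1.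
  have p32 : pinv G 3 2 = - pinv G 2 2 by rewrite -(p3 2%N) // /pinv (crd_dualC metricG).
  rewrite /mcof /next3 !p3 // !p1 // !p32 !p12 /derivedg !bform_rank1_shear !crd_e //=.
  by field.
by move=> w x y; rewrite /nabla_ricci !ricE !nabla1; ring.
Qed.

End Rank1RicciParallel.

(** * Rank 0: totally isotropic derived algebra *)

Lemma bracket_e_central {R : realType} (x : 'rV[R]_6) k : bracket x (e k.+4) = 0.
Proof.
by rewrite /bracket !crd_e //= !(mulr0, subr0, scale0r, addr0).
Qed.

Section Rank0.
Context {R : realType} (G : 'M[R]_6) (metricG : is_metric G).

Lemma flat_rank0 : derived_gram G = 0 -> flat G.
Proof.
move=> E0; have [symG unitG] := metricG.
pose G' : 'M[R]_(3 + 3) := G; pose H : 'M[R]_(3 + 3) := invmx G.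
have defG : G = triple (ulsubmx G') (ursubmx G') (drsubmx G').
  by rewrite /triple trmx_ursub [G'^T]symG submxK.
have zz : drsubmx G' = 0 by rewrite -E0 defG derived_gram_triple.
(* With E = 0 the lower right block of the identity [G *m invmx G = 1] exhibits an inverse of the
   transpose of M. *)
have unitM : ursubmx G' \in unitmx.
  have : block_mx (ulsubmx G') (ursubmx G') (dlsubmx G') (drsubmx G')
      *m block_mx (ulsubmx H) (ursubmx H) (dlsubmx H) (drsubmx H) = 1%:M.
    by rewrite !submxK; exact: mulmxV.
  rewrite mulmx_block scalar_mx_block => /eq_block_mx [_ _ _].
  rewrite zz mul0mx addr0 => /mulmx1_unit [].
  by rewrite -[G' in dlsubmx G']symG -trmx_ursub unitmx_tr.
have E (i j : nat) : (3 < i <= 6)%N -> (3 < j <= 6)%N -> bform G (e i) (e j) = 0.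
  case: i => [|[|[|[|i]]]] // hi; case: j => [|[|[|[|j]]]] // hj.
  have := derived_gramE G (@Ordinal 3 i hi) (@Ordinal 3 j hj); rewrite E0 mxE /derivedg /= => <-.
  by [].
have bb x y z w : bform G (bracket x y) (bracket z w) = 0.
  rewrite bform_bracket !(bformC (e _) (bracket _ _)) // !bform_bracket !E //; ring.
have nabla0 x y (i : 'I_3) : crd (levi_civita G x y) i.+1 = 0.
  set u := levi_civita G x y; pose u' := \row_(k < 3) crd u k.+1.
  suff /rowP /(_ i) : u' = 0 by rewrite !mxE.
  (* The entries of [u' *m M] are the products of [u] with the central basis vectors, which vanish
     by Koszul's formula. *)
  rewrite -[u'](mulmxK unitM) -[RHS](mul0mx _ (invmx (ursubmx G'))); congr (_ *m _).
  apply/rowP => k; rewrite mxE [RHS]mxE.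
  have : bform G u (e k.+4) = 0.
    rewrite bform_levi_civita // /koszul (bracketC (e _)) !bracket_e_central oppr0 !bform0l.
    by rewrite bform_bracket !E ?(ltn_ord k : (3 < k.+4 <= 6)%N) //; ring.
  rewrite defG zz bform_triple => h; rewrite -[RHS]h; apply: eq_bigr => l _.
  have elow (j : 'I_3) : crd (e k.+4 : 'rV[R]_6) j.+1 = 0.
    by rewrite crd_e ?ltn_eqF //; have := ltn_ord j; lia.
  have ehigh (j : 'I_3) : crd (e k.+4 : 'rV[R]_6) j.+4 = (j == k)%:R.
    by rewrite crd_e // (ltn_ord j : (0 < j.+4 <= 6)%N).
  rewrite (bigD1 k) //= big1 ?addr0 => [|j /negbTE jk]; rewrite !elow !ehigh ?jk ?eqxx !mxE /=.
    by ring.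
  by ring.
have nabla x y z w : bform G (levi_civita G x y) (levi_civita G z w) = 0.
  have := nabla0 x y; have := nabla0 z w.
  move: (levi_civita G x y) (levi_civita G z w) => u v v0 u0.
  rewrite defG zz bform_triple big1 // => i _; rewrite big1 // => j _.
  by rewrite !u0 !v0 !mxE; ring.
move=> x y z; apply: (bform_inj unitG) => w.
by rewrite bform_curv // !nabla bb bform0l; ring.
Qed.

End Rank0.

(** * The listed metrics, and the assembly of the theorem *)

Lemma rank2_ricci_parallel_listE {R : realType} (G : 'M[R]_6) :
  rank2_ricci_parallel_list G ->
  exists a b d e1 e2 : R, G = rank2_gram a b d e1 e2.
Proof.
case=> [[c [S [M [[a [d [_ _ -> ->]] ->]]]]]|[S [M [h ->]]]].
  exists a, 0, d, ((-1) ^+ c), ((-1) ^+ c).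
  by rewrite /rank2_gram scale_diag3 mulr0 mulr1.
case: h => [[a [d [_ _ -> ->]]]|[a [_ -> ->]]|[d [_ -> ->]]].
- by exists a, 0, d, 1, (-1).
- by exists a, (`|a| / 2), 0, 1, (-1).
- by exists 0, (`|d| / 2), d, 1, (-1).
Qed.

Lemma rank2_list_ricci_flat {R : realType} (G : 'M[R]_6) :
  is_metric G -> rank2_ricci_flat_list G -> ricci_flat G.
Proof.
move=> mG; case=> [[c [a defG]]|[a defG]|defG|defG].
- have defG' : G = rank2_gram a 0 ((-1) ^+ c - a) ((-1) ^+ c) ((-1) ^+ c).
    by rewrite defG /rank2_gram scale_diag3 mulr0 mulr1.
  rewrite defG' in mG *; apply/(ricci_flat_rank2 mG).
  by rewrite -mulrDl addrC subrK -expr2 sqrr_sign.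
- have defG' : G = rank2_gram a 0 (-1 + a) 1 (-1) by [].
  by rewrite defG' in mG *; apply/(ricci_flat_rank2 mG); ring.
- have defG' : G = rank2_gram 1 2^-1 0 1 (-1) by [].
  by rewrite defG' in mG *; apply/(ricci_flat_rank2 mG); ring.
- have defG' : G = rank2_gram 0 2^-1 (-1) 1 (-1) by [].
  by rewrite defG' in mG *; apply/(ricci_flat_rank2 mG); ring.
Qed.

(** The criterion a e1 + d e2 = 1 of [ricci_flat_rank2] determines s_33 from s_22 in form (b), and
    forces s_22 = 1 in form (f) and s_33 = -1 in form (g). *)
Lemma rank2_ricci_flat_complete {R : realType} (G : 'M[R]_6) :
  is_metric G -> rank2_ricci_parallel_list G -> ricci_flat G -> rank2_ricci_flat_list G.
Proof.
move=> mG; case=> [[c [S [M [[a [d [_ _ -> ->]] defG]]]]]|[S [M [h defG]]]] G0.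
  have defG' : G = rank2_gram a 0 d ((-1) ^+ c) ((-1) ^+ c).
    by rewrite defG /rank2_gram scale_diag3 mulr0 mulr1.
  apply: Or41; exists c, a; rewrite defG; congr (triple (diag3 _ _ _) _ _).
  rewrite defG' in mG G0; move/(ricci_flat_rank2 mG): G0; rewrite -mulrDl => h.
  have := congr1 ( *%R^~ ((-1) ^+ c)) h; rewrite /= -mulrA -expr2 sqrr_sign mulr1 mul1r => <-.
  by ring.
case: h => [[a [d [_ _ defS defM]]]|[a [_ defS defM]]|[d [_ defS defM]]]; subst S M.
- have defG' : G = rank2_gram a 0 d 1 (-1) by [].
  apply: Or42; exists a; rewrite defG; congr (triple (diag3 _ _ _) _ _).
  by rewrite defG' in mG G0; move/(ricci_flat_rank2 mG): G0; lra.
- have defG' : G = rank2_gram a (`|a| / 2) 0 1 (-1) by [].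
  rewrite defG' in mG G0; move/(ricci_flat_rank2 mG): G0 => h.
  have a1 : a = 1 by lra.
  by apply: Or43; rewrite defG a1 normr1 mul1r.
- have defG' : G = rank2_gram 0 (`|d| / 2) d 1 (-1) by [].
  rewrite defG' in mG G0; move/(ricci_flat_rank2 mG): G0 => h.
  have d1 : d = -1 by lra.
  by apply: Or44; rewrite defG d1 normrN1 mul1r.
Qed.

Lemma rank1_locally_symmetric_listE {R : realType} (G : 'M[R]_6) :
  rank1_locally_symmetric_list G ->
  exists s m11 m12 m21 m22 : R, s * s = 1 /\ G = rank1_gram s m11 m12 m21 m22.
Proof.
case=> b [M [h ->]]; exists ((-1) ^+ b).
have -> : (-1) ^+ b *: E10 = diag3 0 0 ((-1) ^+ b) :> 'M[R]_3.
  by rewrite scale_diag3 mulr0 mulr1.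
case: h => [[m11 [m22 ->]]|[m11 [m12 ->]]|[m11 ->]].
- by exists m11, 0, 0, m22; rewrite -expr2 sqrr_sign.
- by exists m11, m12, (- m12), m11; rewrite -expr2 sqrr_sign.
- by exists m11, 0, 1, m11; rewrite -expr2 sqrr_sign.
Qed.

(** The roots of 3 solve [rank1_curvature = 0]: it reads (m22 - m11)^2 = 3 for s = 1 and M diagonal,
    and m12^2 = 3/4 for s = -1, m22 = m11 and m21 = -m12. *)
Lemma rank1_list_flat {R : realType} (G : 'M[R]_6) :
  is_metric G -> rank1_flat_list G -> flat G.
Proof.
have sqrt3 (b : bool) : ((-1) ^+ b * Num.sqrt 3) ^+ 2 = 3 :> R.
  by rewrite exprMn sqrr_sign sqr_sqrtr ?mul1r // ler0n.
move=> mG; case=> -[b [l defG]].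
  have defG' : G = rank1_gram 1 (l + (-1) ^+ b * Num.sqrt 3) 0 0 l by [].
  rewrite defG' in mG *; apply: (flat_rank1 mG); first exact: mulr1.
  rewrite /rank1_curvature; have := sqrt3 b; move: (_ * Num.sqrt 3) => t.
  by move=> h; lra.
have defG' : G = rank1_gram (-1) l (- ((-1) ^+ b * (Num.sqrt 3 / 2)))
    ((-1) ^+ b * (Num.sqrt 3 / 2)) l.
  by rewrite defG -scaleN1r scale_diag3 mulr0 mulr1.
rewrite defG' in mG *; apply: (flat_rank1 mG); first by rewrite mulrNN mulr1.
rewrite /rank1_curvature !(mulrA ((-1) ^+ b) (Num.sqrt 3)).
have := sqrt3 b; move: (_ * Num.sqrt 3) => t.
by move=> h; lra.
Qed.

Lemma rank1_list_ricci_parallel {R : realType} (G : 'M[R]_6) :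
  is_metric G -> rank1_ricci_parallel_list G -> ricci_parallel G.
Proof.
move=> mG [b1 [b2 [l defG]]].
have defG' : G = rank1_shear_gram ((-1) ^+ b1) ((-1) ^+ b2) l.
  by rewrite defG !scale_diag3 !mulr0 !mulr1.
by rewrite defG' in mG *; apply: ricci_parallel_rank1_shear.
Qed.

Theorem proposition4p1 (R : realType) (G : 'M[R]_6) (metricG : is_metric G) :
  [/\ derived_nondegenerate G -> ~ flat G /\ ~ ricci_flat G,
      derived_degenerate_of_rank 2 G ->
        [/\ rank2_ricci_parallel_list G -> ricci_parallel G,
            rank2_ricci_flat_list G -> ricci_flat G &
            rank2_ricci_parallel_list G -> ricci_flat G ->
              rank2_ricci_flat_list G],
      derived_degenerate_of_rank 1 G ->
        [/\ rank1_locally_symmetric_list G ->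
              locally_symmetric G /\ ricci_flat G,
            rank1_flat_list G -> flat G &
            rank1_ricci_parallel_list G -> ricci_parallel G],
      derived_degenerate_of_rank 0 G -> flat G &
      einstein G <-> ricci_flat G].
Proof.
split.
- move=> ndG; have nric := derived_nondegenerate_not_ricci_flat metricG ndG.
  split=> // G0; apply: nric => x y; rewrite (ricci_trace metricG) big1 // => k _.
  by rewrite G0 bform0l.
- move=> _; split.
  + move=> /rank2_ricci_parallel_listE [a [b [d [e1 [e2 defG]]]]].
    by rewrite defG in metricG *; apply: ricci_parallel_rank2.
  + exact: rank2_list_ricci_flat.
  + exact: rank2_ricci_flat_complete.
- move=> _; split.
  + move=> /rank1_locally_symmetric_listE [s [m11 [m12 [m21 [m22 [ss1 defG]]]]]].
    rewrite defG in metricG *.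
    by split; [apply: locally_symmetric_rank1 | apply: ricci_flat_rank1].
  + exact: rank1_list_flat.
  + exact: rank1_list_ricci_parallel.
- by move=> [_ /eqP]; rewrite mxrank_eq0 => /eqP; apply: flat_rank0.
- exact: einstein_ricci_flat.
Qed.
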